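(* For any $m,q,n\in\mathbb{N}$ with $n\ge q+m-1$ and any sequences of complex numbers $a_{(1);N},\ldots,a_{(m);N}$ defined for integers $N$ in $[q,n+1]$, $$P_{m,q,n+1}=a_{(m);n+1}\Big\{a_{(m-1);n}\Big[\cdots a_{(2);n-m+3}\big(a_{(1);n-m+2}(P_{0,q,n-m+1})+P_{1,q,n-m+1}\big)+P_{2,q,n-m+2}\Big]+P_{m-1,q,n-1}\Big\}+P_{m,q,n},$$ where $P_{0,q,n-m+1}=1$. The nested expression on the right means $E_m$, where $E_0=P_{0,q,n-m+1}=1$ and $E_k=a_{(k);\,n-m+k+1}\,E_{k-1}+P_{k,q,n-m+k}$ for $1\le k\le m$.
   Context: $\mathbb{N}=\{0,1,2,\ldots\}$. For given sequences, $P_{k,q,M}=\sum_{q\le N_1<\cdots<N_k\le M}a_{(k);N_k}\cdots a_{(2);N_2}a_{(1);N_1}$ is the multiple sum of order $k$ over all strictly increasing $k$-tuples of integers in $[q,M]$. It uses the first $k$ sequences. For $k=0$ it equals $1$ whatever its bounds; for $k\ge1$ it equals $0$ when there are no such tuples. *)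

(* Defs.v *)
From mathcomp Require Import all_boot all_order all_algebra.
From mathcomp Require Import complex.

Set Implicit Arguments.
Unset Strict Implicit.
Unset Printing Implicit Defensive.

Import GRing.Theory.
Local Open Scope ring_scope.

(* [a k N] stands for a_{(k);N}: the sequences are numbered from 1, and [a 0] is
   never used. *)

(* P_{k,q,M}; since ['I_k] starts at 0, [N i] stands for N_{i+1}. *)
Definition multisum (C : comNzRingType) (a : nat -> nat -> C) (k q M : nat) : C :=
  \sum_(N : {ffun 'I_k -> 'I_M.+1} |
          [forall i : 'I_k, (q <= N i)%N] &&
          [forall i : 'I_k, forall j : 'I_k, (i < j)%N ==> (N i < N j)%N])
     \prod_(i < k) a i.+1 (N i).

(* E_0 = P_{0,q,n-m+1} and E_k = a_{(k);n-m+k+1} E_{k-1} + P_{k,q,n-m+k}. The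
   additions come before the subtractions, so that none of the latter is
   truncated as long as [m <= n.+1]. *)
Fixpoint nested (C : comNzRingType) (a : nat -> nat -> C) (m q n k : nat) : C :=
  match k with
  | 0 => multisum a 0 q (n + 1 - m)
  | k'.+1 => a k (n + k + 1 - m)%N * nested a m q n k' + multisum a k q (n + k - m)
  end.

Lemma multisum0 (C : comNzRingType) (a : nat -> nat -> C) (q M : nat) :
  multisum a 0 q M = 1.
Proof.
rewrite /multisum (big_pred1 [ffun i => ord0]) ?big_ord0 // => N /=.
have -> : N = [ffun i => ord0] by apply/ffunP; case.
by rewrite eqxx; apply/andP; split; apply/forallP; case.
Qed.

Lemma multisum_small (C : comNzRingType) (a : nat -> nat -> C) (k q M : nat) :
  (0 < k)%N -> (M < q)%N -> multisum a k q M = 0.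
Proof.
case: k => // k _ ltMq; apply: big_pred0 => N.
apply/negP => /andP[/forallP/(_ ord0) leqN _].
by have := leq_trans ltMq leqN; rewrite ltnNge -ltnS ltn_ord.
Qed.

(* Main.v *)
Require Import Defs.
From mathcomp Require Import all_boot all_order all_algebra.
From mathcomp Require Import reals.
From mathcomp Require Import complex.

(** Split the increasing tuples counted by [multisum a k.+1 q M.+1] according to
    whether their last entry is [M.+1].  If it is, the other entries form an
    arbitrary increasing [k]-tuple in [[q, M]] and the last entry contributes the
    factor [a k.+1 M.+1]; if it is not, the whole tuple lies in [[q, M]].  This
    is the recurrence [multisum_recr]
      P_{k+1,q,M+1} = a_{(k+1);M+1} P_{k,q,M} + P_{k+1,q,M}.
    The nested expression is this recurrence unfolded along the diagonal on which
    order and upper bound drop together, down to order 0: by induction on [k],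
    E_k = P_{k,q,n-m+k+1} ([nested_multisum]), and [k = m] is the theorem. *)

Import GRing.Theory.
Local Open Scope ring_scope.

(** Kept convertible to the range condition in [multisum], so that the latter can
    be folded into it. *)
Definition increasing_from {k M : nat} (q : nat) (N : {ffun 'I_k -> 'I_M.+1}) :=
  [forall i : 'I_k, (q <= N i)%N] &&
  [forall i : 'I_k, forall j : 'I_k, (i < j)%N ==> (N i < N j)%N].

Lemma increasing_fromP (k M q : nat) (N : {ffun 'I_k -> 'I_M.+1}) :
  reflect ((forall i, q <= N i)%N /\
           forall i j : 'I_k, (i < j)%N -> (N i < N j)%N)
          (increasing_from q N).
Proof.
apply: (iffP andP) => -[ge_q incr]; split.
- exact/forallP.
- by move=> i j; move/forallP: incr => /(_ i)/forallP/(_ j)/implyP.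
- exact/forallP.
- by apply/forallP => i; apply/forallP => j; apply/implyP; apply: incr.
Qed.

(** The order of the tuple is a successor because the last entry, being the
    largest, is what keeps all the entries below [M.+1]. *)
Lemma multisum_last_small (C : comNzRingType) (a : nat -> nat -> C)
    (k q M : nat) :
  \sum_(N : {ffun 'I_k.+1 -> 'I_M.+2} |
          increasing_from q N && (N ord_max != ord_max))
     \prod_(i < k.+1) a i.+1 (N i) = multisum a k.+1 q M.
Proof.
pose widen (N : {ffun 'I_k.+1 -> 'I_M.+1}) : {ffun 'I_k.+1 -> 'I_M.+2} :=
  [ffun i => widen_ord (leqnSn M.+1) (N i)].
pose narrow (N : {ffun 'I_k.+1 -> 'I_M.+2}) : {ffun 'I_k.+1 -> 'I_M.+1} :=
  [ffun i => inord (N i)].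
have widenE N i : widen N i = N i :> nat by rewrite ffunE.
have widenK N : narrow (widen N) = N.
  by apply/ffunP => i; apply: val_inj; rewrite !ffunE /= inord_val.
rewrite (reindex_onto widen narrow) /=; last first.
  move=> N /andP[/increasing_fromP[_ incr] lastN].
  have lastM : (N ord_max < M.+1)%N.
    by move: lastN; rewrite -val_eqE /= ltn_neqAle -ltnS ltn_ord andbT.
  apply/ffunP => i; apply: ord_inj; rewrite widenE ffunE inordK //.
  have [->//|neq_i] := eqVneq i ord_max.
  apply: ltn_trans lastM; apply: incr.
  by move: neq_i; rewrite -val_eqE /= ltn_neqAle -ltnS ltn_ord andbT.
apply: eq_big => [N|N _]; last by apply: eq_bigr => i _; rewrite widenE.
rewrite widenK eqxx andbT -/(increasing_from q N).
have -> : (widen N ord_max != ord_max) = true.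
  by rewrite -val_eqE /= widenE neq_ltn ltn_ord.
rewrite andbT; apply/increasing_fromP/increasing_fromP => -[ge_q incr].
- split=> [i|i j lt_ij]; first by rewrite -widenE.
  by rewrite -!widenE; apply: incr.
- split=> [i|i j lt_ij]; first by rewrite widenE.
  by rewrite !widenE; apply: incr.
Qed.

(** For [M.+1 < q] the tuple with the single entry [M.+1] would not be counted on
    the left, while the right-hand side can be nonzero when [k = 0]; hence the
    hypothesis. *)
Lemma multisum_last_max (C : comNzRingType) (a : nat -> nat -> C)
    (k q M : nat) : (q <= M.+1)%N ->
  \sum_(N : {ffun 'I_k.+1 -> 'I_M.+2} |
          increasing_from q N && (N ord_max == ord_max))
     \prod_(i < k.+1) a i.+1 (N i) = a k.+1 M.+1 * multisum a k q M.
Proof.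
move=> le_qM.
pose extend (N : {ffun 'I_k -> 'I_M.+1}) : {ffun 'I_k.+1 -> 'I_M.+2} :=
  [ffun i => if unlift ord_max i is Some j
             then widen_ord (leqnSn M.+1) (N j) else ord_max].
pose restrict (N : {ffun 'I_k.+1 -> 'I_M.+2}) : {ffun 'I_k -> 'I_M.+1} :=
  [ffun j => inord (N (lift ord_max j))].
have extend_lift N j : extend N (lift ord_max j) = N j :> nat.
  by rewrite ffunE liftK.
have extend_max N : extend N ord_max = ord_max by rewrite ffunE unlift_none.
have extendK N : restrict (extend N) = N.
  by apply/ffunP => j; apply: ord_inj; rewrite ffunE extend_lift inord_val.
rewrite (reindex_onto extend restrict) /=; last first.
  move=> N /andP[/increasing_fromP[_ incr] /eqP lastN].
  apply/ffunP => i; case: (unliftP ord_max i) => [j|] ->; last first.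
    by rewrite extend_max lastN.
  apply: ord_inj; rewrite extend_lift ffunE inordK //.
  have := incr (lift ord_max j) ord_max.
  by rewrite lastN lift_max /= => -> //; apply: ltn_ord.
rewrite /multisum big_distrr /=.
apply: eq_big => [N|N _]; last first.
  rewrite big_ord_recr /= extend_max mulrC; congr (_ * _).
  apply: eq_bigr => i _; congr (a _ _).
  rewrite -extend_lift; congr (val (extend N _)).
  by apply: ord_inj; rewrite lift_max.
rewrite extendK extend_max !eqxx !andbT -/(increasing_from q N).
apply/increasing_fromP/increasing_fromP => -[ge_q incr].
- split=> [i|i j lt_ij]; first by rewrite -extend_lift.
  by rewrite -!extend_lift; apply: incr; rewrite !lift_max.
- split=> [i|i j].
    by case: (unliftP ord_max i) => [j|] ->; rewrite ?extend_lift ?extend_max.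
  case: (unliftP ord_max i) => [i'|] ->; last by rewrite ltnNge -ltnS ltn_ord.
  case: (unliftP ord_max j) => [j'|] ->.
    by rewrite !lift_max !extend_lift; apply: incr.
  by rewrite extend_lift extend_max => _; apply: ltn_ord.
Qed.

Lemma multisum_recr (C : comNzRingType) (a : nat -> nat -> C) (k q M : nat) :
  (q <= M.+1)%N ->
  multisum a k.+1 q M.+1
    = a k.+1 M.+1 * multisum a k q M + multisum a k.+1 q M.
Proof.
move=> le_qM; rewrite -multisum_last_max // -(multisum_last_small _ a k q M).
exact: (bigID (fun N : {ffun 'I_k.+1 -> 'I_M.+2} => N ord_max == ord_max)).
Qed.

(** One step of the nesting is exactly one use of [multisum_recr] at upper bound
    [n + k.+1 - m]. The hypothesis puts all these bounds at [q] or above, so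
    that the recurrence applies, and keeps the subtractions from being truncated. *)
Lemma nested_multisum (C : comNzRingType) (a : nat -> nat -> C)
    (m q n k : nat) : (q + m <= n + 1)%N ->
  nested a m q n k = multisum a k q (n + k + 1 - m).
Proof.
move=> le_qm; elim: k => [|k IHk]; first by rewrite /= !multisum0.
have le_m : (m <= n + k.+1)%N.
  apply: leq_trans (leq_addl q m) (leq_trans le_qm _).
  by rewrite leq_add2l.
rewrite /= IHk addn1 subSn // multisum_recr.
  by rewrite addn1 -addnS.
rewrite -subSn // leq_subRL; last exact: leqW.
by rewrite addnC (leq_trans le_qm) // -addnS leq_add2l.
Qed.

Theorem theorem2p2 (R : realType) (m q n : nat) (a : nat -> nat -> R[i])
    (hn : (q + m <= n + 1)%N) :
  multisum a m q (n + 1) = nested a m q n m /\ multisum a 0 q (n + 1 - m) = 1.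
Proof.
split; last exact: multisum0.
by rewrite nested_multisum // addnAC addnK.
Qed.
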